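(* Let $d,T,N,k\ge 1$ be integers with $k\le N$, let $\bar\mu\in\mathbb{R}^d$, and let $\sigma,\bar\sigma>0$. Let $\mu_1,\dots,\mu_T$ be i.i.d. from $\mathcal N(\bar\mu,\bar\sigma^2\mathbb I_d)$ and, given these, for each $i$ let $X_i=\{X_{i,1},\dots,X_{i,N}\}$ be $N$ i.i.d. samples from $\mathcal N(\mu_i,\sigma^2\mathbb I_d)$ (independently across $i$). Let $\hat\mu=\frac1T\sum_{i=1}^T\frac1N\sum_{j=1}^N X_{i,j}$. Let $\tau\in\{1,\dots,T\}$ be the index of the target task, and let the strong adversary receive a challenge set $B$ of $k$ samples as described in the context (in the IN case, $B$ consists of $k$ samples drawn uniformly at random from $X_\tau$). Let $\mu_B=\frac1k\sum_{x\in B}x$ and $z=\langle \hat\mu-\bar\mu,\ \mu_B-\bar\mu\rangle$, and write $z_{OUT}$, $z_{IN}$ for $z$ in the OUT and IN cases respectively. Then, with expectation over the sampling of the tasks and the data, $$\mathbb E[z_{OUT}]=0\qquad\text{and}\qquad \mathbb E[z_{IN}]=\frac dT\Big(\bar\sigma^2+\frac{\sigma^2}{N}\Big).$$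
   Context: $\mathbb I_d$ is the $d\times d$ identity matrix and $\langle\cdot,\cdot\rangle$ is the Euclidean inner product on $\mathbb R^d$. The challenge set $B$, $|B|=k$, is generated in one of two ways. OUT case: the challenge task was not used to compute $\hat\mu$: a fresh task mean $\mu_{OUT}\sim\mathcal N(\bar\mu,\bar\sigma^2\mathbb I_d)$ is drawn independently of all $\mu_i$ and $X_i$, and $B$ consists of $k$ i.i.d. samples from $\mathcal N(\mu_{OUT},\sigma^2\mathbb I_d)$, independent of $\hat\mu$. IN case for the strong adversary: $B$ consists of $k$ of the $N$ samples in $X_\tau$ (the same samples used in computing $\hat\mu$), chosen uniformly at random without replacement, with the choice independent of the values of the data. *)

(* Defs.v *)
From HB Require Import structures.
From mathcomp Require Import all_boot all_order all_algebra.
From mathcomp Require Import all_classical all_reals all_analysis.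

Set Implicit Arguments.
Unset Strict Implicit.
Unset Printing Implicit Defensive.

Import Order.TTheory GRing.Theory Num.Theory.
Import numFieldNormedType.Exports.

Local Open Scope classical_set_scope.
Local Open Scope ring_scope.

Definition dotp (R : realType) (d : nat) (u v : 'rV[R]_d) : R :=
  \sum_(c < d) u 0 c * v 0 c.

Definition box (R : realType) (d : nat) (C : 'I_d -> set R) : set 'rV[R]_d :=
  [set v | forall c, C c (v 0 c)].

(* The mass that N(m, s^2 I_d), i.e. the product over c of the univariate laws
   N(m_c, s^2), gives to [box C].  Boxes with measurable sides form a pi-system
   generating the Borel sets of R^d, so these values determine the law.
   The second argument of [normal_prob] is the standard deviation. *)
Definition iso_normal_box (R : realType) (d : nat) (m : 'rV[R]_d) (s : R)
    (C : 'I_d -> set R) : \bar R :=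
  (\prod_(c < d) normal_prob (m 0%R c) s (C c))%E.

Definition random_vector (disp : measure_display) (Omega : measurableType disp)
    (R : realType) (d : nat) (V : Omega -> 'rV[R]_d) : Prop :=
  forall c : 'I_d, measurable_fun [set: Omega] (fun w => V w 0 c).

Definition iid_tasks (disp : measure_display) (Omega : measurableType disp)
    (R : realType) (P : probability Omega R) (d n : nat)
    (mubar : 'rV[R]_d) (sbar : R) (mu : 'I_n -> Omega -> 'rV[R]_d) : Prop :=
  (forall i, random_vector (mu i)) /\
  forall A : 'I_n -> 'I_d -> set R, (forall i c, measurable (A i c)) ->
    P [set w | forall i, box (A i) (mu i w)] =
    (\prod_(i < n) iso_normal_box mubar sbar (A i))%E.

(* Given (mu_i)_i, the X_{i,j} are independent with X_{i,j} ~ N(mu_i, s^2 I_d):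
   the conditional law of X given mu is the product kernel, i.e.
   P(mu in A, X in C) = E[1_{mu in A} prod_{i,j} N(mu_i, s^2 I_d)(C_{i,j})]. *)
Definition samples_given_tasks (disp : measure_display)
    (Omega : measurableType disp) (R : realType) (P : probability Omega R)
    (d n K : nat) (s : R) (mu : 'I_n -> Omega -> 'rV[R]_d)
    (X : 'I_n -> 'I_K -> Omega -> 'rV[R]_d) : Prop :=
  (forall i j, random_vector (X i j)) /\
  forall (A : 'I_n -> 'I_d -> set R) (C : 'I_n -> 'I_K -> 'I_d -> set R),
    (forall i c, measurable (A i c)) ->
    (forall i j c, measurable (C i j c)) ->
    P ([set w | forall i, box (A i) (mu i w)] `&`
       [set w | forall i j, box (C i j) (X i j w)]) =
    (\int[P]_(w in [set w | forall i, box (A i) (mu i w)])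
       \prod_(i < n) \prod_(j < K) iso_normal_box (mu i w) s (C i j))%E.

Definition coord_events (disp : measure_display) (Omega : measurableType disp)
    (R : realType) (d : nat) (V : Omega -> 'rV[R]_d) : set (set Omega) :=
  [set E | exists c : 'I_d, exists2 C : set R,
     measurable C & E = [set w | C (V w 0 c)]].

Definition sigma_family (disp : measure_display) (Omega : measurableType disp)
    (R : realType) (d : nat) (I : Type) (V : I -> Omega -> 'rV[R]_d) :
    set (set Omega) :=
  <<s \bigcup_i coord_events (V i) >>.

Definition indep_classes (disp : measure_display) (Omega : measurableType disp)
    (R : realType) (P : probability Omega R) (F G : set (set Omega)) : Prop :=
  forall E H, F E -> G H -> P (E `&` H) = (P E * P H)%E.

Definition tasks_and_data (Omega : Type) (R : realType) (d n K : nat)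
    (mu : 'I_n -> Omega -> 'rV[R]_d) (X : 'I_n -> 'I_K -> Omega -> 'rV[R]_d)
    (a : 'I_n + 'I_n * 'I_K) : Omega -> 'rV[R]_d :=
  match a with inl i => mu i | inr p => X p.1 p.2 end.

Definition mu_hat (Omega : Type) (R : realType) (d T N : nat)
    (X : 'I_T -> 'I_N -> Omega -> 'rV[R]_d) (w : Omega) : 'rV[R]_d :=
  T%:R^-1 *: \sum_(i < T) (N%:R^-1 *: \sum_(j < N) X i j w).

(* OUT: a fresh task mu_out and its k samples Y; the hierarchical law is that
   of a single task, hence the families indexed by 'I_1. *)
Definition out_challenge (disp : measure_display) (Omega : measurableType disp)
    (R : realType) (P : probability Omega R) (d T N k : nat)
    (mubar : 'rV[R]_d) (sbar s : R) (mu : 'I_T -> Omega -> 'rV[R]_d)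
    (X : 'I_T -> 'I_N -> Omega -> 'rV[R]_d)
    (mu_out : Omega -> 'rV[R]_d) (Y : 'I_k -> Omega -> 'rV[R]_d) : Prop :=
  [/\ iid_tasks P mubar sbar (fun _ : 'I_1 => mu_out),
      samples_given_tasks P s (fun _ : 'I_1 => mu_out) (fun _ : 'I_1 => Y),
      indep_classes P (sigma_family (fun _ : unit => mu_out))
        (sigma_family (tasks_and_data mu X)) &
      indep_classes P (sigma_family Y)
        (sigma_family (fun _ : unit => mu_hat X))].

Definition mu_B_out (Omega : Type) (R : realType) (d k : nat)
    (Y : 'I_k -> Omega -> 'rV[R]_d) (w : Omega) : 'rV[R]_d :=
  k%:R^-1 *: \sum_(j < k) Y j w.

(* IN: the challenge set is { X_{tau,j} | j in S } where S is a uniformly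
   random k-subset of the sample indices, independent of the data. *)
Definition in_challenge (disp : measure_display) (Omega : measurableType disp)
    (R : realType) (P : probability Omega R) (d T N k : nat)
    (X : 'I_T -> 'I_N -> Omega -> 'rV[R]_d) (S : Omega -> {set 'I_N}) : Prop :=
  [/\ forall A : {set 'I_N}, measurable [set w | S w = A],
      forall A : {set 'I_N},
        P [set w | S w = A] = (if #|A| == k then 'C(N, k)%:R^-1 else 0)%:E &
      indep_classes P [set E | exists Q : set {set 'I_N}, E = S @^-1` Q]
        (sigma_family (fun p : 'I_T * 'I_N => X p.1 p.2))].

Definition mu_B_in (Omega : Type) (R : realType) (d T N : nat) (k : nat)
    (X : 'I_T -> 'I_N -> Omega -> 'rV[R]_d) (tau : 'I_T)
    (S : Omega -> {set 'I_N}) (w : Omega) : 'rV[R]_d :=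
  k%:R^-1 *: \sum_(j in S w) X tau j w.

Definition z_stat (Omega : Type) (R : realType) (d : nat) (mubar : 'rV[R]_d)
    (muhat muB : Omega -> 'rV[R]_d) (w : Omega) : R :=
  dotp (muhat w - mubar) (muB w - mubar).

(* Main.v *)
(* Writing W_ij = X_ij - mubar, conditioning on the task means gives
   E W_ij = 0 and E[W_ij W_kl] = [i = k] sbar^2 + [(i,j) = (k,l)] s^2
   coordinatewise, while z is bilinear in the W's.  In the OUT case z is a
   product of independent centred variables; in the IN case one conditions on
   the random index set S and the mean does not depend on the k-subset.

   The laws are only known on boxes, so conditional means are computed by
   extending identities between measures, one variable at a time, from
   indicators to nonnegative functions, and then to integrable ones by splitting
   into positive and negative parts. *)
Require Import Defs.
From HB Require Import structures.
From mathcomp Require Import all_boot all_order all_algebra.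
From mathcomp Require Import all_classical all_reals all_analysis.
From mathcomp Require Import measurable_realfun.
From mathcomp Require Import ring lra.

Set Implicit Arguments.
Unset Strict Implicit.
Unset Printing Implicit Defensive.

Import Order.TTheory GRing.Theory Num.Theory.
Import numFieldNormedType.Exports.

Local Open Scope classical_set_scope.
Local Open Scope ring_scope.

(** * Integrals against a family of probability laws *)

(** Expanding z over coordinates, and over samples or index sets, leaves only expectations of
    products of two real variables. For such a pair the hypotheses give the mass of every rectangle
    C x D, and passing from rectangles to products of functions takes only linearity and monotone
    convergence, so no joint law on a product space has to be identified. The recurring obstacle is
    integrability, without which positive and negative parts cannot be recombined. Hence squares are
    always treated before means: a nonnegative function needs no integrability beforehand, and
    finite second moments then make both factors and their product integrable. *)

Section Disintegration.
Local Open Scope ereal_scope.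
Context d (T : measurableType d) d' (Z : measurableType d') (R : realType).
Variables (mu : {measure set T -> \bar R}) (U : T -> Z) (h h' : T -> R)
  (K : T -> {measure set Z -> \bar R}).
Hypotheses (mU : measurable_fun [set: T] U)
  (mh : measurable_fun [set: T] h) (h0 : forall w, (0 <= h w)%R)
  (mh' : measurable_fun [set: T] h') (h'0 : forall w, (0 <= h' w)%R)
  (mK : forall C, measurable C -> measurable_fun [set: T] (K ^~ C))
  (hK : forall C, measurable C ->
    \int[mu]_(w in U @^-1` C) (h w)%:E = \int[mu]_w ((h' w)%:E * K w C)).

Import HBNNSimple.

Let mhE : measurable_fun [set: T] (fun w => (h w)%:E).
Proof. exact/measurable_EFinP. Qed.

Let mh'E : measurable_fun [set: T] (fun w => (h' w)%:E).
Proof. exact/measurable_EFinP. Qed.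

Let h0E w : 0 <= (h w)%:E. Proof. by rewrite lee_fin. Qed.

Let h'0E w : 0 <= (h' w)%:E. Proof. by rewrite lee_fin. Qed.

Lemma measurable_ge0_integral (f : Z -> \bar R) :
  measurable_fun [set: Z] f -> (forall z, 0 <= f z) ->
  measurable_fun [set: T] (fun w => \int[K w]_z f z).
Proof. by move=> mf f0; exact: measurable_fun_integral_kernel. Qed.

(** Simple functions: both sides split over the fibres of [f], and [hK] is applied to each fibre. *)
Let disint_nnsfun (f : {nnsfun Z >-> R}) :
  \int[mu]_w ((h w)%:E * (f (U w))%:E) = \int[mu]_w ((h' w)%:E * \int[K w]_z (f z)%:E).
Proof.
have mfU y : measurable_fun [set: T] (fun w => (\1_(f @^-1` [set y]) (U w))%:E : \bar R).
  apply/measurable_EFinP.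
  exact: (measurableT_comp (measurable_indic (measurable_funPTI f (measurable_set1 y))) mU).
have LHSE w : (h w)%:E * (f (U w))%:E =
    \sum_(y \in range f) (h w)%:E * (y * \1_(f @^-1` [set y]) (U w))%:E.
  rewrite fimfunE -fsumEFin// ge0_mule_fsumr// => y.
  by rewrite EFinM nnfun_muleindic_ge0.
have RHSE w : (h' w)%:E * \int[K w]_z (f z)%:E =
    \sum_(y \in range f) (h' w)%:E * (y%:E * K w (f @^-1` [set y])).
  rewrite -ge0_mule_fsumr; last first.
    move=> y; have := mulemu_ge0 (fun n => f @^-1` [set n]).
    by apply; exact: preimage_nnfun0.
  congr (_ * _); under eq_integral do rewrite fimfunE -fsumEFin//.
  rewrite /= ge0_integral_fsum//; last 2 first.
  - by move=> r; exact/measurable_EFinP/measurableT_comp.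
  - by move=> r z _; rewrite EFinM nnfun_muleindic_ge0.
  apply: eq_fsbigr => r _.
  rewrite (integralZl_indic _ (fun r => f @^-1` [set r]))//; last first.
    by move=> r0; rewrite preimage_nnfun0.
  by rewrite integral_indic// setIT.
under eq_integral do rewrite LHSE.
under [RHS]eq_integral do rewrite RHSE.
rewrite ge0_integral_fsum//; last 2 first.
- move=> y; apply: emeasurable_funM => //; under eq_fun do rewrite EFinM.
  exact: measurable_funeM.
- by move=> y w _; apply: mule_ge0 => //; rewrite EFinM nnfun_muleindic_ge0.
rewrite ge0_integral_fsum//; last 2 first.
- move=> y; apply: emeasurable_funM => //; apply: measurable_funeM; exact: mK.
- move=> y w _; apply: mule_ge0 => //.
  have := mulemu_ge0 (fun n => f @^-1` [set n]).
  by apply; exact: preimage_nnfun0.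
apply: eq_fsbigr => y _.
(* Taking the scalar [y] out of the integrals requires [0 <= y]; a negative [y] has an empty fibre,
   so both terms vanish. *)
have [y0|y0] := leP 0%R y; last first.
  rewrite !integral0_eq// => w _.
    by rewrite preimage_nnfun0// measure0 !mule0.
  by rewrite preimage_nnfun0// indic0 mulr0 mule0.
under eq_integral do rewrite EFinM muleCA.
under [RHS]eq_integral do rewrite muleCA.
have mC : measurable (f @^-1` [set y]) by [].
rewrite !ge0_integralZl//; last 4 first.
- by apply: emeasurable_funM => //; exact: mK.
- by move=> w _; exact: mule_ge0.
- exact: emeasurable_funM.
- by move=> w _; apply: mule_ge0 => //; rewrite lee_fin.
rewrite -hK// [in RHS]integral_mkcond; congr (_ * _); apply: eq_integral => w _.
rewrite patchE indicE.
have -> : (w \in U @^-1` (f @^-1` [set y])) = (U w \in f @^-1` [set y]).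
  by apply/idP/idP; rewrite !inE.
by case: ifP; rewrite ?mule1 ?mule0.
Qed.

(** Monotone convergence is used twice, inside each [K w] and then under [mu]. The two weights serve
    to treat one variable at a time: [h] carries the other variable and [h'] its conditional
    mean. *)
Lemma ge0_integral_disintegration (f : Z -> \bar R) :
  measurable_fun [set: Z] f -> (forall z, 0 <= f z) ->
  \int[mu]_w ((h w)%:E * f (U w)) = \int[mu]_w ((h' w)%:E * \int[K w]_z f z).
Proof.
move=> mf f0; pose f_ := nnsfun_approx measurableT mf.
have ndf z a b : (a <= b)%N -> ((f_ a z)%:E <= (f_ b z)%:E).
  by move=> ab; rewrite lee_fin; exact/lefP/nd_nnsfun_approx.
have f_0 n z : 0 <= (f_ n z)%:E by rewrite lee_fin.
have mf_ n : measurable_fun [set: Z] (fun z => (f_ n z)%:E) by exact/measurable_EFinP.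
have cf z : (f_ n z)%:E @[n --> \oo] --> f z by exact: cvg_nnsfun_approx.
have fK w : \int[K w]_z (f_ n z)%:E @[n --> \oo] --> \int[K w]_z f z.
  under [X in _ --> X]eq_integral => z _ do rewrite -(cvg_lim _ (cf z))//.
  apply: cvg_monotone_convergence => //.
  by move=> z _ a b; exact: ndf.
transitivity (\int[mu]_w limn (fun n => (h w)%:E * (f_ n (U w))%:E)).
  apply: eq_integral => w _; apply/esym/cvg_lim => //.
  exact: cvgeZl.
rewrite monotone_convergence//; last 3 first.
- by move=> n; apply: emeasurable_funM => //; exact: (measurableT_comp (mf_ n) mU).
- by move=> n w _; exact: mule_ge0.
- by move=> w _ a b ab; rewrite lee_wpmul2l// ndf.
transitivity (\int[mu]_w limn (fun n => (h' w)%:E * \int[K w]_z (f_ n z)%:E)).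
  rewrite [RHS]monotone_convergence//; last 3 first.
  - move=> n; apply: emeasurable_funM => //.
    exact: measurable_ge0_integral.
  - by move=> n w _; apply: mule_ge0 => //; exact: integral_ge0.
  - move=> w _ a b ab; rewrite lee_wpmul2l// ge0_le_integral// => z _.
    exact: ndf.
  by congr (limn _); apply/funext => n; rewrite disint_nnsfun.
apply: eq_integral => w _; apply/cvg_lim => //.
exact: cvgeZl.
Qed.

End Disintegration.

(** Integrability travels with the value, so that linear combinations of means need no side
    conditions. *)
Definition has_mean d (T : measurableType d) (R : realType)
    (mu : {measure set T -> \bar R}) (f : T -> R) (v : R) : Prop :=
  mu.-integrable [set: T] (EFin \o f) /\ (\int[mu]_w (f w)%:E = v%:E)%E.

Section HasMean.
Context d (T : measurableType d) (R : realType).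
Variable mu : {measure set T -> \bar R}.
Implicit Types (f g : T -> R) (u v : R).

Lemma integrable_has_mean f : mu.-integrable [set: T] (EFin \o f) ->
  has_mean mu f (fine (\int[mu]_w (f w)%:E)).
Proof. by move=> fi; split; rewrite // fineK//; exact: integrable_fin_num. Qed.

Lemma has_mean_measurable f v : has_mean mu f v -> measurable_fun [set: T] f.
Proof. by move=> [/measurable_int/measurable_EFinP]. Qed.

Lemma has_mean_unique f u v : has_mean mu f u -> has_mean mu f v -> u = v.
Proof. by move=> [_ fu] [_]; rewrite fu => -[]. Qed.

Lemma ge0_has_mean f v : measurable_fun [set: T] f -> (forall w, 0 <= f w) ->
  (\int[mu]_w (f w)%:E = v%:E)%E -> has_mean mu f v.
Proof.
move=> mf f0 fv; split => //; apply/integrableP; split.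
  exact/measurable_EFinP.
by rewrite (eq_integral (fun w => (f w)%:E)) ?fv ?ltry// => w _; rewrite /= ger0_norm.
Qed.

Lemma eq_has_mean f g v : f =1 g -> has_mean mu f v -> has_mean mu g v.
Proof. by move=> /funext ->. Qed.

Lemma has_meanD f g u v : has_mean mu f u -> has_mean mu g v ->
  has_mean mu (fun w => f w + g w) (u + v).
Proof.
move=> [fi fu] [gi gv]; split; first exact: (integrableD measurableT fi gi).
by rewrite EFinD -fu -gv; exact: (integralD measurableT fi gi).
Qed.

Lemma has_meanZ f (c : R) u : has_mean mu f u ->
  has_mean mu (fun w => c * f w) (c * u).
Proof.
move=> [fi fu]; split.
  apply: eq_integrable (integrableZl measurableT c fi) => //.
by rewrite EFinM -fu; exact: (integralZl measurableT fi).
Qed.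

Lemma has_meanN f u : has_mean mu f u -> has_mean mu (fun w => - f w) (- u).
Proof.
by move/(has_meanZ (-1)); rewrite mulN1r; apply: eq_has_mean => w; rewrite mulN1r.
Qed.

Lemma has_meanB f g u v : has_mean mu f u -> has_mean mu g v ->
  has_mean mu (fun w => f w - g w) (u - v).
Proof. by move=> fu /has_meanN; exact: has_meanD. Qed.

Lemma has_mean_sum (I : Type) (s : seq I) (p : pred I) (f : I -> T -> R)
    (u : I -> R) : (forall i, p i -> has_mean mu (f i) (u i)) ->
  has_mean mu (fun w => \sum_(i <- s | p i) f i w) (\sum_(i <- s | p i) u i).
Proof.
move=> fu; elim: s => [|i s ih].
  rewrite big_nil; apply: (@eq_has_mean (cst 0)) => [w|]; first by rewrite big_nil.
  by apply: ge0_has_mean => //; rewrite integral0_eq.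
rewrite big_cons; under eq_fun do rewrite big_cons.
by case: ifPn => // pi; apply: has_meanD => //; exact: fu.
Qed.

Lemma has_mean_sum0 (I : Type) (s : seq I) (p : pred I) (f : I -> T -> R) :
    (forall i, p i -> has_mean mu (f i) 0) ->
  has_mean mu (fun w => \sum_(i <- s | p i) f i w) 0.
Proof. by move/has_mean_sum => /(_ s); rewrite big1. Qed.

(** Domination by |fg| <= f^2 + g^2. *)
Lemma integrableM_sqr f g :
  measurable_fun [set: T] f -> measurable_fun [set: T] g ->
  mu.-integrable [set: T] (fun w => (f w ^+ 2)%:E) ->
  mu.-integrable [set: T] (fun w => (g w ^+ 2)%:E) ->
  mu.-integrable [set: T] (fun w => (f w * g w)%:E).
Proof.
move=> mf mg fi gi.
apply: (le_integrable measurableT _ _ (integrableD measurableT fi gi)).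
  by apply/measurable_EFinP; exact: measurable_funM.
move=> w _ /=; rewrite lee_fin [leRHS]ger0_norm ?addr_ge0 ?sqr_ge0// normrM.
rewrite -(real_normK (num_real (f w))) -(real_normK (num_real (g w))).
have := normr_ge0 (f w); have := normr_ge0 (g w); nra.
Qed.

End HasMean.

Lemma has_mean_cst d (T : measurableType d) (R : realType)
  (P : probability T R) (c : R) : has_mean P (cst c) c.
Proof.
split; first exact: finite_measure_integrable_cst.
by have := expectation_cst P c; rewrite unlock.
Qed.

(** * Products of two conditionally independent variables *)

Section ConditionallyIndependentProduct.
Context d (T : measurableType d) d1 (Z1 : measurableType d1)
  d2 (Z2 : measurableType d2) (R : realType).
Variables (P : probability T R) (U1 : T -> Z1) (U2 : T -> Z2)
  (K1 : T -> probability Z1 R) (K2 : T -> probability Z2 R).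
Hypotheses (mU1 : measurable_fun [set: T] U1) (mU2 : measurable_fun [set: T] U2)
  (mK1 : forall C, measurable C -> measurable_fun [set: T] (K1 ^~ C))
  (mK2 : forall C, measurable C -> measurable_fun [set: T] (K2 ^~ C))
  (hK : forall C1 C2, measurable C1 -> measurable C2 ->
    P (U1 @^-1` C1 `&` U2 @^-1` C2) = (\int[P]_w (K1 w C1 * K2 w C2))%E).

Let measurable_mean d' (Z : measurableType d') (K : T -> probability Z R)
    (g : Z -> R) (b : T -> R) :
    (forall C, measurable C -> measurable_fun [set: T] (K ^~ C)) ->
    (forall z, 0 <= g z) -> (forall w, has_mean (K w) g (b w)) ->
  measurable_fun [set: T] b.
Proof.
move=> mK g0 gb; apply/measurable_EFinP.
apply: (eq_measurable_fun (fun w => \int[K w]_z (g z)%:E)%E) => [w _|].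
  by have [_ ->] := gb w.
apply: measurable_ge0_integral => //.
(* Measurability of [g] does not depend on the law, so it is read off at an arbitrary parameter. *)
by apply/measurable_EFinP; exact: has_mean_measurable (gb point).
Qed.

Lemma ge0_integral_cindep (g1 : Z1 -> R) (g2 : Z2 -> R) (b1 b2 : T -> R) :
    (forall z, 0 <= g1 z) -> (forall z, 0 <= g2 z) ->
    (forall w, has_mean (K1 w) g1 (b1 w)) ->
    (forall w, has_mean (K2 w) g2 (b2 w)) ->
  (\int[P]_w (g1 (U1 w) * g2 (U2 w))%:E = \int[P]_w (b1 w * b2 w)%:E)%E.
Proof.
move=> g10 g20 gb1 gb2.
have mg1 := has_mean_measurable (gb1 point).
have mg2 := has_mean_measurable (gb2 point).
have mb1 := measurable_mean mK1 g10 gb1.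
have mb2 := measurable_mean mK2 g20 gb2.
have b20 w : 0 <= b2 w.
  have [_ e] := gb2 w; rewrite -lee_fin -e; apply: integral_ge0 => z _.
  by rewrite lee_fin.
have fK1 w C : measurable C -> K1 w C \is a fin_num.
  by move=> mC; exact: fin_num_measure.
transitivity (\int[P]_w ((g2 (U2 w))%:E * (g1 (U1 w))%:E))%E.
  by apply: eq_integral => w _; rewrite mulrC.
rewrite (@ge0_integral_disintegration _ _ _ _ _ P U1 (g2 \o U2) b2 K1 _ _ _ _ _ _ _ (EFin \o g1))//.
- by apply: eq_integral => w _; have [_ ->] := gb1 w; rewrite mulrC.
- exact: measurableT_comp.
- move=> w; exact: g20.
- move=> C1 mC1; rewrite integral_mkcond.
  transitivity (\int[P]_w ((\1_(U1 @^-1` C1) w)%:E * (g2 (U2 w))%:E))%E.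
    apply: eq_integral => w _; rewrite patchE indicE /=.
    by case: ifP; rewrite ?mul1e ?mul0e.
  have mUC1 : measurable (U1 @^-1` C1) by rewrite -[X in measurable X]setTI; exact: mU1.
  rewrite (@ge0_integral_disintegration _ _ _ _ _ P U2 (\1_(U1 @^-1` C1))
    (fun w => fine (K1 w C1)) K2 _ _ _ _ _ _ _ (EFin \o g2))//.
  + by apply: eq_integral => w _; have [_ ->] := gb2 w; rewrite fineK ?fK1// muleC.
  + by apply: measurableT_comp => //; exact: mK1.
  + by move=> w; exact: fine_ge0.
  + move=> C2 mC2; under [RHS]eq_integral do rewrite fineK ?fK1//.
    rewrite integral_indic//; last first.
      by rewrite -[X in measurable X]setTI; exact: mU2.
    exact: hK.
  + exact/measurable_EFinP.
- exact/measurable_EFinP.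
Qed.

Lemma has_mean_cindep (f1 : Z1 -> R) (f2 : Z2 -> R) (a1 a2 : T -> R) (v : R) :
    (forall w, has_mean (K1 w) f1 (a1 w)) ->
    (forall w, has_mean (K2 w) f2 (a2 w)) ->
    P.-integrable [set: T] (fun w => (f1 (U1 w) * f2 (U2 w))%:E) ->
    has_mean P (fun w => a1 w * a2 w) v ->
  has_mean P (fun w => f1 (U1 w) * f2 (U2 w)) v.
Proof.
move=> fa1 fa2 f12 a12.
have mf1 := has_mean_measurable (fa1 point).
have mf2 := has_mean_measurable (fa2 point).
pose b1p w := fine (\int[K1 w]_z (f1^\+ z)%:E)%E.
pose b1n w := fine (\int[K1 w]_z (f1^\- z)%:E)%E.
pose b2p w := fine (\int[K2 w]_z (f2^\+ z)%:E)%E.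
pose b2n w := fine (\int[K2 w]_z (f2^\- z)%:E)%E.
have h1p w : has_mean (K1 w) f1^\+ (b1p w).
  by apply/integrable_has_mean/integrable_funrpos => //; have [] := fa1 w.
have h1n w : has_mean (K1 w) f1^\- (b1n w).
  by apply/integrable_has_mean/integrable_funrneg => //; have [] := fa1 w.
have h2p w : has_mean (K2 w) f2^\+ (b2p w).
  by apply/integrable_has_mean/integrable_funrpos => //; have [] := fa2 w.
have h2n w : has_mean (K2 w) f2^\- (b2n w).
  by apply/integrable_has_mean/integrable_funrneg => //; have [] := fa2 w.
have fE S (f : S -> R) z : f z = f^\+ z - f^\- z by rewrite -{1}(funrposBneg f).
have a1E w : a1 w = b1p w - b1n w.
  apply: has_mean_unique (fa1 w) _; apply: eq_has_mean (has_meanB (h1p w) (h1n w)).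
  by move=> z; rewrite [RHS]fE.
have a2E w : a2 w = b2p w - b2n w.
  apply: has_mean_unique (fa2 w) _; apply: eq_has_mean (has_meanB (h2p w) (h2n w)).
  by move=> z; rewrite [RHS]fE.
(* Each of the four sign products is dominated by |f1 f2|, hence integrable. The nonnegative case
   gives the product of conditional means the same finite integral, so both sides can be recombined
   with signs. *)
have part (g1 : Z1 -> R) (g2 : Z2 -> R) (b1 b2 : T -> R) :
    (forall z, 0 <= g1 z <= `|f1 z|) -> (forall z, 0 <= g2 z <= `|f2 z|) ->
    (forall w, has_mean (K1 w) g1 (b1 w)) ->
    (forall w, has_mean (K2 w) g2 (b2 w)) ->
    exists u, has_mean P (fun w => g1 (U1 w) * g2 (U2 w)) u /\
              has_mean P (fun w => b1 w * b2 w) u.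
  move=> g1f g2f gb1 gb2.
  have g10 z : 0 <= g1 z by have /andP[] := g1f z.
  have g20 z : 0 <= g2 z by have /andP[] := g2f z.
  have b_ge0 d' (Z : measurableType d') (K : probability Z R) (g : Z -> R) b :
      (forall z, 0 <= g z) -> has_mean K g b -> 0 <= b.
    move=> g0 [_ e]; rewrite -lee_fin -e; apply: integral_ge0 => z _.
    by rewrite lee_fin.
  have mg : measurable_fun [set: T] (fun w => g1 (U1 w) * g2 (U2 w)).
    apply: measurable_funM; apply: measurableT_comp => //.
      exact: has_mean_measurable (gb1 point).
    exact: has_mean_measurable (gb2 point).
  have gi : has_mean P (fun w => g1 (U1 w) * g2 (U2 w))
      (fine (\int[P]_w (g1 (U1 w) * g2 (U2 w))%:E)).
    apply: integrable_has_mean; apply: le_integrable f12 => //.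
      exact/measurable_EFinP.
    move=> w _ /=; rewrite lee_fin !normrM !(ger0_norm (g10 _), ger0_norm (g20 _)).
    by have /andP[_ ?] := g1f (U1 w); have /andP[_ ?] := g2f (U2 w); exact: ler_pM.
  exists (fine (\int[P]_w (g1 (U1 w) * g2 (U2 w))%:E)); split => //.
  have [_ e] := gi; apply: ge0_has_mean; last by rewrite -e (ge0_integral_cindep g10 g20 gb1 gb2).
    by apply: measurable_funM; [exact: measurable_mean gb1|exact: measurable_mean gb2].
  by move=> w; apply: mulr_ge0; [exact: b_ge0 (gb1 w)|exact: b_ge0 (gb2 w)].
have pf S (f : S -> R) z : 0 <= f^\+ z <= `|f z|.
  by rewrite funrpos_ge0/= ge_max normr_ge0 ler_norm.
have nf S (f : S -> R) z : 0 <= f^\- z <= `|f z|.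
  by rewrite funrneg_ge0/= ge_max normr_ge0 -normrN ler_norm.
have [u1 [x1 y1]] := part _ _ _ _ (pf _ f1) (pf _ f2) h1p h2p.
have [u2 [x2 y2]] := part _ _ _ _ (pf _ f1) (nf _ f2) h1p h2n.
have [u3 [x3 y3]] := part _ _ _ _ (nf _ f1) (pf _ f2) h1n h2p.
have [u4 [x4 y4]] := part _ _ _ _ (nf _ f1) (nf _ f2) h1n h2n.
have -> : v = (u1 - u2) - (u3 - u4).
  apply: has_mean_unique a12 _.
  apply: eq_has_mean (has_meanB (has_meanB y1 y2) (has_meanB y3 y4)) => w.
  by rewrite a1E a2E; ring.
apply: eq_has_mean (has_meanB (has_meanB x1 x2) (has_meanB x3 x4)) => w.
by rewrite (fE _ f1) (fE _ f2); ring.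
Qed.

End ConditionallyIndependentProduct.

(** * Moments of the normal law *)

Section NormalMoments.
Context (R : realType) (m s : R) (s0 : s != 0).
Local Notation leb := (@lebesgue_measure R).
Local Notation pdf := (normal_pdf m s).

(* Disintegrating [pdf dx] along the identity, with the constant family N(m, s^2),
   shows that normal_prob has density pdf. *)
Lemma ge0_integral_normal_prob (f : R -> R) :
  measurable_fun [set: R] f -> (forall x, 0 <= f x) ->
  (\int[normal_prob m s]_x (f x)%:E = \int[leb]_x (pdf x * f x)%:E)%E.
Proof.
move=> mf f0; have mpdf := measurable_normal_pdf m s.
have := @ge0_integral_disintegration _ _ _ (measurableTypeR R) R leb
  (idfun : R -> measurableTypeR R) pdf pdf (fun=> normal_prob m s)
  _ _ _ _ _ _ _ (EFin \o f).
rewrite /= => ->//.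
- rewrite ge0_integralZr//=.
  + by rewrite integral_normal_pdf mul1e.
  + exact/measurable_EFinP.
  + by move=> x _; rewrite lee_fin normal_pdf_ge0.
  + by apply: integral_ge0 => x _; rewrite lee_fin.
- exact: measurable_id.
- by move=> x; exact: normal_pdf_ge0.
- by move=> x; exact: normal_pdf_ge0.
- move=> C mC; rewrite ge0_integralZr//=.
  + by rewrite integral_normal_pdf mul1e.
  + exact/measurable_EFinP.
  + by move=> x _; rewrite lee_fin normal_pdf_ge0.
- exact/measurable_EFinP.
Qed.

Lemma is_derive_normal_pdf (x : R) :
  is_derive x 1 pdf (- (x - m) / s ^+ 2 * pdf x).
Proof.
rewrite normal_pdfE// /normal_fun.
have s20 : s ^+ 2 != 0 by rewrite expf_neq0.
apply: is_derive_eq.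
rewrite /GRing.scale /= /normal_fun.
by field.
Qed.

(** Symmetry about [m] gives the density equal values at both ends; [n.+1] keeps the interval
    nondegenerate, as the fundamental theorem of calculus requires. *)
Let itv n : set R := `[m - n.+1%:R, m + n.+1%:R].

Let bigcup_itv : \bigcup_n itv n = [set: R].
Proof.
apply/seteqP; split => // x _; exists (Num.truncn `|x - m|) => //=.
have := truncnS_gt `|x - m|; rewrite ltr_norml => /andP[a b].
by rewrite /itv /= in_itv /=; apply/andP; split; lra.
Qed.

Let nd_itv : nondecreasing_seq itv.
Proof.
move=> i j ij; apply/subsetPset => x; rewrite /itv /= !in_itv/= => /andP[a b].
have : (i.+1%:R : R) <= j.+1%:R by rewrite ler_nat.
by move=> ?; apply/andP; split; lra.
Qed.

Let cvg_itv (f : R -> R) : measurable_fun [set: R] f -> (forall x, 0 <= f x) ->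
  (\int[leb]_(x in itv n) (f x)%:E @[n --> \oo] --> \int[leb]_x (f x)%:E)%E.
Proof.
move=> mf f0; rewrite -[in X in _ --> X]bigcup_itv.
apply: ge0_nondecreasing_set_cvg_integral => //.
- by move=> i; exact: measurable_itv.
- by move=> i; apply/measurable_EFinP; exact: measurable_funTS.
- by move=> i x _; rewrite lee_fin.
Qed.

(** With t = n+1 and y = t^2 / (2 s^2), the bound exp y >= y gives t exp(-y) <= t / y = 2 s^2 /
    t. *)
Let tail_bound n :
  0 <= n.+1%:R * pdf (m + n.+1%:R) <= normal_peak s * (2 * s ^+ 2) * n.+1%:R^-1.
Proof.
have n0 : 0 < n.+1%:R :> R by [].
rewrite mulr_ge0 ?normal_pdf_ge0//= normal_pdfE// /normal_fun.
have -> : m + n.+1%:R - m = n.+1%:R :> R by ring.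
set y := n.+1%:R ^+ 2 / (s ^+ 2 *+ 2).
have s20 : 0 < s ^+ 2 by rewrite exprn_even_gt0.
have y0 : 0 < y by rewrite divr_gt0 ?exprn_gt0// pmulrn_lgt0.
have -> : - n.+1%:R ^+ 2 / (s ^+ 2 *+ 2) = - y by rewrite mulNr.
rewrite expRN mulrCA -mulrA ler_wpM2l ?normal_peak_ge0//.
have -> : 2 * s ^+ 2 / n.+1%:R = n.+1%:R * y^-1.
  by rewrite /y; move: (n.+1%:R : R) n0 => N N0; field; rewrite s0 gt_eqF.
rewrite ler_pM2l// lef_pV2 ?posrE ?expR_gt0//.
by apply: le_trans (expR_ge1Dx y); lra.
Qed.

(* Integrating [primitive a]' over a symmetric interval around m expresses the
   truncated second moment about a through the truncated mass, up to a boundary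
   term that [tail_bound] controls; the mean is then recovered from the second
   moments about a - 1 and a. *)
Let primitive a (x : R) := - s ^+ 2 * ((x + m - a *+ 2) * pdf x).

(** The factor x + m - 2a is chosen because (x - m)(x + m - 2a) = (x - a)^2 - (m - a)^2, while pdf'
    brings out -(x - m) / s^2. *)
Let is_derive_primitive a (x : R) : is_derive x 1 (primitive a)
  ((x - a) ^+ 2 * pdf x - ((m - a) ^+ 2 + s ^+ 2) * pdf x).
Proof.
have := is_derive_normal_pdf x => dpdf.
rewrite /primitive; apply: is_derive_eq.
by rewrite /GRing.scale /= ; field.
Qed.

Let integral_itv a n : (\int[leb]_(x in itv n) (pdf x * (x - a) ^+ 2)%:E =
  ((m - a) ^+ 2 + s ^+ 2)%:E * \int[leb]_(x in itv n) (pdf x)%:E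
  - (2 * s ^+ 2 * (n.+1%:R * pdf (m + n.+1%:R)))%:E)%E.
Proof.
have mitv : measurable (itv n) by exact: measurable_itv.
have cpdf := @continuous_normal_pdf R m s s0.
have dcont (f : R -> R) : (forall x, derivable f x 1) -> continuous f.
  by move=> df x; apply: differentiable_continuous; apply/derivable1_diffP.
pose g x := pdf x * (x - a) ^+ 2 - ((m - a) ^+ 2 + s ^+ 2) * pdf x.
have csq : continuous (fun x : R => pdf x * (x - a) ^+ 2).
  by apply: dcont => x; have dpdf := is_derive_normal_pdf x; apply: ex_derive.
have cg : continuous g.
  by apply: dcont => x; have dpdf := is_derive_normal_pdf x; apply: ex_derive.
have cint (f : R -> R) : continuous f -> leb.-integrable (itv n) (EFin \o f).
  move=> cf; apply: continuous_compact_integrable; first exact: segment_compact.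
  exact: continuous_subspaceT.
have ab : m - n.+1%:R < m + n.+1%:R by rewrite ltrD2l gtrN.
have cF : continuous (primitive a).
  by apply: dcont => x; have [] := is_derive_primitive a x.
have ftc : (\int[leb]_(x in itv n) (g x)%:E =
    (primitive a (m + n.+1%:R))%:E - (primitive a (m - n.+1%:R))%:E)%E.
  apply: continuous_FTC2 => //.
  - exact: continuous_subspaceT.
  - split.
    + by move=> x _; have [] := is_derive_primitive a x.
    + by apply: cvg_at_right_filter; exact: cF.
    + by apply: cvg_at_left_filter; exact: cF.
  - move=> x _; rewrite derive1E /g.
    by have [_ ->] := is_derive_primitive a x; rewrite [pdf x * _]mulrC.
(* With equal densities at both ends, only the difference 2(n+1) of the linear factors of
   [primitive a] remains. *)
have pdf_sym : pdf (m - n.+1%:R) = pdf (m + n.+1%:R).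
  rewrite normal_pdfE// /normal_fun.
  by rewrite (_ : m - n.+1%:R - m = - (m + n.+1%:R - m)) ?sqrrN//; ring.
have -> : (- (2 * s ^+ 2 * (n.+1%:R * pdf (m + n.+1%:R)))%:E =
    \int[leb]_(x in itv n) (g x)%:E)%E.
  by rewrite ftc -EFinB -EFinN /primitive pdf_sym; congr EFin; ring.
rewrite -integralZl//; last exact: cint.
rewrite -integralD//.
- by apply: eq_integral => x _; rewrite /g -!EFinM -EFinD; congr EFin; ring.
- by apply: integrableZl => //; exact: cint.
- exact: cint.
Qed.

Lemma has_mean_normal_sqr a :
  has_mean (normal_prob m s) (fun x => (x - a) ^+ 2) ((m - a) ^+ 2 + s ^+ 2).
Proof.
have msq : measurable_fun [set: R] (fun x => (x - a) ^+ 2).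
  by apply: measurable_funX; exact: measurable_funB.
have mpdf := measurable_normal_pdf m s.
apply: ge0_has_mean => //; first by move=> x; exact: sqr_ge0.
rewrite ge0_integral_normal_prob//; last by move=> x; exact: sqr_ge0.
have := @cvg_itv (fun x => pdf x * (x - a) ^+ 2).
have /[swap]/[apply] : measurable_fun [set: R] (fun x => pdf x * (x - a) ^+ 2).
  exact: measurable_funM.
have /[swap]/[apply] : forall x, 0 <= pdf x * (x - a) ^+ 2.
  by move=> x; rewrite mulr_ge0 ?normal_pdf_ge0 ?sqr_ge0.
move=> lhs.
suff rhs : (\int[leb]_(x in itv n) (pdf x * (x - a) ^+ 2)%:E @[n --> \oo] -->
    ((m - a) ^+ 2 + s ^+ 2)%:E * 1 - 0)%E.
  by rewrite (cvg_unique _ lhs rhs)// mule1 sube0.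
under eq_fun do rewrite integral_itv.
apply: cvgeB => //.
  rewrite -(integral_normal_pdf m s).
  by apply: cvgeZl => //; apply: cvg_itv => // x; exact: normal_pdf_ge0.
apply/cvg_EFin; first by near=> n.
(* The coefficient of the boundary term times the constant of [tail_bound]. *)
pose C := 2 * s ^+ 2 * (normal_peak s * (2 * s ^+ 2)).
apply: (@squeeze_cvgr _ _ _ _ (cst 0) (fun n => C * n.+1%:R^-1)).
- near=> n; have /andP[t0 t1] := tail_bound n.
  have c0 : 0 <= 2 * s ^+ 2 by rewrite mulr_ge0 ?sqr_ge0.
  by rewrite /= mulr_ge0//= /C -[leRHS]mulrA; exact: ler_wpM2l.
- exact: cvg_cst.
- rewrite -(mulr0 C); apply: cvgM; first exact: cvg_cst.
  exact: cvg_harmonic.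
Unshelve. all: by end_near. Qed.

(** From (x - a + 1)^2 - (x - a)^2 - 1 = 2(x - a); integrability is inherited from the squares. *)
Lemma has_mean_normal a : has_mean (normal_prob m s) (fun x => x - a) (m - a).
Proof.
have h := has_meanB (has_meanB (has_mean_normal_sqr (a - 1))
  (has_mean_normal_sqr a)) (has_mean_cst (normal_prob m s) 1).
have -> : m - a = 2^-1 * ((m - (a - 1)) ^+ 2 + s ^+ 2 -
  ((m - a) ^+ 2 + s ^+ 2) - 1) by field.
by apply: eq_has_mean (has_meanZ 2^-1 h) => x /=; field.
Qed.

End NormalMoments.

(** The density restricted to [C] is jointly measurable in mean and point, so Tonelli makes its
    partial integral measurable in the mean. This turns the conditional law of a sample into a
    kernel. *)
Lemma measurable_normal_prob (R : realType) (s : R) (C : set R) :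
  s != 0 -> measurable C ->
  measurable_fun [set: R] (fun m => normal_prob m s C).
Proof.
move=> s0 mC; rewrite /normal_prob.
under eq_fun do rewrite integral_mkcond.
pose k (p : R * R) := (((fun x => (normal_pdf p.1 s x)%:E) \_ C) p.2)%E.
have mk : measurable_fun [set: R * R] k.
  rewrite (_ : k = (fun p => (\1_C p.2 *
    (normal_peak s * expR (- (p.2 - p.1) ^+ 2 / (s ^+ 2 *+ 2))))%:E)); last first.
    apply/funext => p; rewrite /k patchE indicE normal_pdfE//.
    by case: ifP; rewrite ?mul1r ?mul0r.
  apply/measurable_EFinP; apply: measurable_funM.
    apply: (measurableT_comp (f := \1_C : R -> R)) => //.
  apply: measurable_funM => //; apply: measurableT_comp => //.
  apply: measurable_funM => //; apply: measurableT_comp => //.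
  by apply: measurable_funX; apply: measurable_funB.
apply: (@measurable_fun_fubini_tonelli_F _ _ R (measurableTypeR R) R
  (@lebesgue_measure R) k) => //.
by move=> p; rewrite /k patchE; case: ifP => // _; rewrite lee_fin normal_pdf_ge0.
Qed.

(** * One variable with a random law *)

Section Mixture.
Context d (T : measurableType d) d' (Z : measurableType d') (R : realType).
Variables (P : probability T R) (U : T -> Z) (K : T -> probability Z R).
Hypotheses (mU : measurable_fun [set: T] U)
  (mK : forall C, measurable C -> measurable_fun [set: T] (K ^~ C))
  (hK : forall C, measurable C -> P (U @^-1` C) = (\int[P]_w K w C)%E).

(* Pairs U with a constant variable, so that the one-variable case is an instance
   of the conditionally independent product. *)
Let hK1 (C : set Z) (D : set unit) : measurable C -> measurable D ->
  P (U @^-1` C `&` (fun=> tt) @^-1` D) =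
    (\int[P]_w (K w C * @dirac _ unit tt R D))%E.
Proof.
move=> mC mD; rewrite diracE; have [tD|tD] := boolP (tt \in D).
  rewrite (_ : _ @^-1` D = setT) ?setIT ?hK//.
    by apply: eq_integral => w _; rewrite mule1.
  by apply/seteqP; split => // w _; rewrite /preimage /=; exact: set_mem.
rewrite (_ : _ @^-1` D = set0) ?setI0 ?measure0.
  by rewrite integral0_eq// => w _; rewrite mule0.
by apply/seteqP; split => // w wD; move: tD; rewrite mem_set.
Qed.

Lemma ge0_has_mean_mixture (g : Z -> R) (b : T -> R) (v : R) :
    (forall z, 0 <= g z) -> (forall w, has_mean (K w) g (b w)) ->
  has_mean P b v -> has_mean P (g \o U) v.
Proof.
move=> g0 gb [_ bv]; apply: ge0_has_mean.
- by apply: measurableT_comp => //; exact: has_mean_measurable (gb point).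
- by move=> w; exact: g0.
- have h := @ge0_integral_cindep _ _ _ _ _ _ _ P U (fun=> tt) K
    (fun=> @dirac _ unit tt R) mU _ mK _ hK1 g (cst 1) b (cst 1) g0 _ gb.
  rewrite (eq_integral (fun w => (g (U w) * 1)%:E)); last by move=> w _; rewrite mulr1.
  rewrite h//; first by rewrite -bv; apply: eq_integral => w _; rewrite mulr1.
  by move=> w; exact: has_mean_cst.
Qed.

Lemma has_mean_mixture (f : Z -> R) (a : T -> R) (v : R) :
    (forall w, has_mean (K w) f (a w)) ->
    P.-integrable [set: T] (EFin \o (f \o U)) ->
  has_mean P a v -> has_mean P (f \o U) v.
Proof.
move=> fa fi av.
have h := @has_mean_cindep _ _ _ _ _ _ _ P U (fun=> tt) K
    (fun=> @dirac _ unit tt R) mU _ mK _ hK1 f (cst 1) a (cst 1) v fa.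
apply: (eq_has_mean _ (h _ _ _ _ _)) => //.
- by move=> w; rewrite /= mulr1.
- by move=> w; exact: has_mean_cst.
- by apply: eq_integrable fi => // w _; rewrite /= mulr1.
- by apply: eq_has_mean av => w; rewrite mulr1.
Qed.

End Mixture.

Lemma integral_probability_cst d (T : measurableType d) (R : realType)
  (P : probability T R) (a : \bar R) : (\int[P]_w a = a)%E.
Proof.
rewrite (integral_cst P measurableT a) -[RHS]mule1; congr (_ * _)%E.
exact: probability_setT.
Qed.

(** * The hierarchical model *)

(** Unconstrained sides have normal mass 1, so such boxes reduce the vector laws to laws of the
    [c]-th coordinates. *)
Definition slab (R : realType) (d : nat) (c : 'I_d) (B : set R) : 'I_d -> set R :=
  fun e => if e == c then B else setT.

Lemma measurable_slab (R : realType) (d : nat) (c : 'I_d) (B : set R) e :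
  measurable B -> measurable (slab c B e).
Proof. by rewrite /slab; case: ifP. Qed.

Lemma box_slab (R : realType) (d : nat) (c : 'I_d) (B : set R) (v : 'rV[R]_d) :
  box (slab c B) v = B (v 0 c).
Proof.
apply/propext; split => [/(_ c)|Bv e]; first by rewrite /slab eqxx.
by rewrite /slab; case: eqP => [->|].
Qed.

Lemma iso_normal_box_slab (R : realType) (d : nat) (c : 'I_d) (B : set R)
  (m : 'rV[R]_d) (s : R) : iso_normal_box m s (slab c B) = normal_prob (m 0 c) s B.
Proof.
rewrite /iso_normal_box (bigD1 c)//= /slab eqxx big1 ?mule1// => e /negPf ->.
exact: probability_setT.
Qed.

Section CylinderSets.
Context (R : realType) (I : finType).
Implicit Types (p q k : I) (C D : set R).

Definition cylinder1 p C : I -> set R := fun k => if k == p then C else setT.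

(** Extracts the law of a pair from that of a family. For [p = q] the constraint [D] would be lost,
    whence [p != q] below. *)
Definition cylinder2 p q C D : I -> set R :=
  fun k => if k == p then C else if k == q then D else setT.

Lemma measurable_cylinder1 p C k : measurable C -> measurable (cylinder1 p C k).
Proof. by rewrite /cylinder1; case: ifP. Qed.

Lemma measurable_cylinder2 p q C D k : measurable C -> measurable D ->
  measurable (cylinder2 p q C D k).
Proof. by rewrite /cylinder2; case: ifP => //; case: ifP. Qed.

Lemma cylinder1E (T : Type) (V : I -> T -> R) p C :
  [set w | forall k, cylinder1 p C k (V k w)] = V p @^-1` C.
Proof.
apply/seteqP; split => w /=.
  by move=> /(_ p); rewrite /cylinder1 eqxx.
by move=> Cw k; rewrite /cylinder1; case: eqP => [->|].
Qed.

Lemma cylinder2E (T : Type) (V : I -> T -> R) p q C D : p != q ->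
  [set w | forall k, cylinder2 p q C D k (V k w)] = V p @^-1` C `&` V q @^-1` D.
Proof.
move=> pq; apply/seteqP; split => w /=.
  move=> h; split; first by have := h p; rewrite /cylinder2 eqxx.
  by have := h q; rewrite /cylinder2 eq_sym (negPf pq) eqxx.
move=> [Cw Dw] k; rewrite /cylinder2; case: eqP => [->//|_].
by case: eqP => [->|].
Qed.

Lemma prod_cylinder1 (F : I -> set R -> \bar R) p C :
  (forall k, F k setT = 1%E) -> (\prod_k F k (cylinder1 p C k) = F p C)%E.
Proof.
move=> F1; rewrite (bigD1 p)//= /cylinder1 eqxx big1 ?mule1// => k /negPf ->.
exact: F1.
Qed.

Lemma prod_cylinder2 (F : I -> set R -> \bar R) p q C D : p != q ->
  (forall k, F k setT = 1%E) ->
  (\prod_k F k (cylinder2 p q C D k) = F p C * F q D)%E.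
Proof.
move=> pq F1; rewrite (bigD1 p)//= (bigD1 q) 1?eq_sym//= /cylinder2 !eqxx.
rewrite [q == p]eq_sym (negPf pq) big1 ?mule1// => k /andP[/negPf -> /negPf ->].
exact: F1.
Qed.

End CylinderSets.

Section HierarchicalMoments.
Context (disp : measure_display) (Omega : measurableType disp) (R : realType)
  (P : probability Omega R) (d n K : nat) (mubar : 'rV[R]_d) (sbar s : R)
  (mu : 'I_n -> Omega -> 'rV[R]_d) (X : 'I_n -> 'I_K -> Omega -> 'rV[R]_d).
Hypotheses (s0 : s != 0) (sbar0 : sbar != 0)
  (hmu : iid_tasks P mubar sbar mu) (hX : samples_given_tasks P s mu X).
Variable c : 'I_d.

Let M i (w : Omega) : R := mu i w 0 c.
(** Indexing by pairs makes the samples one flat finite family, to which the cylinder lemmas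
    apply. *)
Let V (p : 'I_n * 'I_K) (w : Omega) : R := X p.1 p.2 w 0 c.
Let b : R := mubar 0 c.

Let mM i : measurable_fun [set: Omega] (M i).
Proof. by have [h _] := hmu; exact: h. Qed.

Let mV p : measurable_fun [set: Omega] (V p).
Proof. by have [h _] := hX; exact: h. Qed.

Let tasks_law (B : 'I_n -> set R) : (forall i, measurable (B i)) ->
  P [set w | forall i, B i (M i w)] = (\prod_(i < n) normal_prob b sbar (B i))%E.
Proof.
move=> mB; have [_ h] := hmu; have := h (fun i => slab c (B i)).
under eq_set do under eq_forall do rewrite box_slab.
under eq_bigr do rewrite iso_normal_box_slab.
by apply => i e; exact: measurable_slab.
Qed.

Let samples_law (B : 'I_n * 'I_K -> set R) : (forall p, measurable (B p)) ->
  P [set w | forall p, B p (V p w)] =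
    (\int[P]_w \prod_p normal_prob (M p.1 w) s (B p))%E.
Proof.
move=> mB; have [_ h] := hX.
(* Leaving the task means unconstrained extends the integral to the whole space. *)
have := h (fun _ _ => setT) (fun i j => slab c (B (i, j))).
have -> : [set w | forall i, box (fun=> setT) (mu i w)] = setT.
  by apply/seteqP; split.
rewrite setTI => h'.
transitivity (P [set w | forall i j, box (slab c (B (i, j))) (X i j w)]).
  congr (P _); apply/seteqP; split => w /=.
    by move=> Bw i j; rewrite box_slab; exact: (Bw (i, j)).
  by move=> Bw [i j]; have := Bw i j; rewrite box_slab.
rewrite h'//; last by move=> i j e; exact: measurable_slab.
apply: eq_integral => w _; rewrite pair_big/=.
by apply: eq_bigr => -[i j] _; rewrite iso_normal_box_slab.
Qed.

Let mK (p : 'I_n * 'I_K) (C : set R) : measurable C ->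
  measurable_fun [set: Omega] (fun w => normal_prob (M p.1 w) s C).
Proof.
by move=> mC; apply: (measurableT_comp (measurable_normal_prob s0 mC) (mM p.1)).
Qed.

Lemma has_mean_task_sqr i :
  has_mean P (fun w => (mu i w 0 c - mubar 0 c) ^+ 2) (sbar ^+ 2).
Proof.
apply: (@ge0_has_mean_mixture _ _ _ (measurableTypeR R) _ P (M i) (fun=> normal_prob b sbar)
  (mM i) _ _ (fun x => (x - b) ^+ 2) (cst (sbar ^+ 2))) => //.
- move=> C mC; rewrite -cylinder1E tasks_law; last first.
    by move=> k; exact: measurable_cylinder1.
  rewrite (prod_cylinder1 (F := fun=> normal_prob b sbar)); last first.
    by move=> _; exact: probability_setT.
  by rewrite integral_probability_cst.
- by move=> z; exact: sqr_ge0.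
- by move=> w; have := has_mean_normal_sqr b sbar0 b; rewrite subrr expr0n add0r.
- exact: has_mean_cst.
Qed.

Let integrable_sqr_mul (f g : Omega -> R) u v :
  measurable_fun [set: Omega] f -> measurable_fun [set: Omega] g ->
  has_mean P (fun w => f w ^+ 2) u -> has_mean P (fun w => g w ^+ 2) v ->
  P.-integrable [set: Omega] (fun w => (f w * g w)%:E).
Proof. by move=> mf mg [fi _] [gi _]; exact: integrableM_sqr. Qed.

(** L^2 lies in L^1 for a probability: pair [f] with the constant 1. *)
Let integrable_sqr (f : Omega -> R) u :
  measurable_fun [set: Omega] f ->
  has_mean P (fun w => f w ^+ 2) u -> P.-integrable [set: Omega] (EFin \o f).
Proof.
move=> mf fu; have h1 := has_mean_cst P 1.
have {}h1 : has_mean P (fun w => cst 1 w ^+ 2) 1.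
  by apply: eq_has_mean h1 => w; rewrite /= expr1n.
apply: eq_integrable (integrable_sqr_mul mf _ fu h1) => // w _ /=.
by rewrite mulr1.
Qed.

Let mMb i : measurable_fun [set: Omega] (fun w => M i w - b).
Proof. exact: measurable_funB. Qed.

Let mVb p : measurable_fun [set: Omega] (fun w => V p w - b).
Proof. exact: measurable_funB. Qed.

Lemma has_mean_task i : has_mean P (fun w => mu i w 0 c - mubar 0 c) 0.
Proof.
apply: (@has_mean_mixture _ _ _ (measurableTypeR R) _ P (M i) (fun=> normal_prob b sbar)
  (mM i) _ _ (fun x => x - b) (cst 0)) => //.
- move=> C mC; rewrite -cylinder1E tasks_law; last first.
    by move=> k; exact: measurable_cylinder1.
  rewrite (prod_cylinder1 (F := fun=> normal_prob b sbar)); last first.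
    by move=> _; exact: probability_setT.
  by rewrite integral_probability_cst.
- by move=> w; have := has_mean_normal b sbar0 b; rewrite subrr.
- exact: integrable_sqr (mMb i) (has_mean_task_sqr i).
- exact: has_mean_cst.
Qed.

Lemma has_mean_taskM i i' : has_mean P
  (fun w => (mu i w 0 c - mubar 0 c) * (mu i' w 0 c - mubar 0 c))
  ((i == i')%:R * sbar ^+ 2).
Proof.
have [<-|ii'] := eqVneq i i'.
  by rewrite mul1r; apply: eq_has_mean (has_mean_task_sqr i) => w; rewrite expr2.
rewrite mul0r.
apply: (@has_mean_cindep _ _ _ (measurableTypeR R) _ (measurableTypeR R) _ P (M i) (M i')
  (fun=> normal_prob b sbar) (fun=> normal_prob b sbar) (mM i) (mM i') _ _ _
  (fun x => x - b) (fun x => x - b) (cst 0) (cst 0)) => //.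
- move=> C D mC mD; rewrite -cylinder2E// tasks_law; last first.
    by move=> k; exact: measurable_cylinder2.
  rewrite (prod_cylinder2 (F := fun=> normal_prob b sbar))//; last first.
    by move=> _; exact: probability_setT.
  by rewrite integral_probability_cst.
- by move=> w; have := has_mean_normal b sbar0 b; rewrite subrr.
- by move=> w; have := has_mean_normal b sbar0 b; rewrite subrr.
- exact: integrable_sqr_mul (mMb i) (mMb i') (has_mean_task_sqr i) (has_mean_task_sqr i').
- by apply: eq_has_mean (has_mean_cst P 0) => w; rewrite /= mul0r.
Qed.

Let law1 p (C : set R) : measurable C ->
  P (V p @^-1` C) = (\int[P]_w normal_prob (M p.1 w) s C)%E.
Proof.
move=> mC; rewrite -cylinder1E samples_law; last first.
  by move=> k; exact: measurable_cylinder1.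
apply: eq_integral => w _.
rewrite (prod_cylinder1 (F := fun p => normal_prob (M p.1 w) s))//.
by move=> k; exact: probability_setT.
Qed.

(** Given the task mean M, the second moment about [b] is (M - b)^2 + s^2, and averaging over M
    gives the sum of the variances. *)
Lemma has_mean_sample_sqr i j :
  has_mean P (fun w => (X i j w 0 c - mubar 0 c) ^+ 2) (sbar ^+ 2 + s ^+ 2).
Proof.
apply: (@ge0_has_mean_mixture _ _ _ (measurableTypeR R) _ P (V (i, j))
  (fun w => normal_prob (M i w) s) (mV (i, j)) (mK (i, j)) (law1 (i, j))
  (fun x => (x - b) ^+ 2) (fun w => (M i w - b) ^+ 2 + s ^+ 2)) => //.
- by move=> z; exact: sqr_ge0.
- by move=> w; exact: has_mean_normal_sqr.
- exact: has_meanD (has_mean_task_sqr i) (has_mean_cst _ _).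
Qed.

Lemma has_mean_sample i j : has_mean P (fun w => X i j w 0 c - mubar 0 c) 0.
Proof.
apply: (@has_mean_mixture _ _ _ (measurableTypeR R) _ P (V (i, j))
  (fun w => normal_prob (M i w) s) (mV (i, j)) (mK (i, j)) (law1 (i, j))
  (fun x => x - b) (fun w => M i w - b)) => //.
- by move=> w; exact: has_mean_normal.
- exact: integrable_sqr (mVb (i, j)) (has_mean_sample_sqr i j).
- exact: has_mean_task.
Qed.

(** Distinct samples are conditionally independent even within one task, so their covariance is that
    of the task means; only the diagonal receives the extra [s ^+ 2]. *)
Lemma has_mean_sampleM i j i' j' : has_mean P
  (fun w => (X i j w 0 c - mubar 0 c) * (X i' j' w 0 c - mubar 0 c))
  ((i == i')%:R * sbar ^+ 2 + ((i, j) == (i', j'))%:R * s ^+ 2).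
Proof.
have [[<- <-]|pq] := eqVneq (i, j) (i', j').
  rewrite eqxx !mul1r.
  by apply: eq_has_mean (has_mean_sample_sqr i j) => w; rewrite expr2.
rewrite mul0r addr0.
apply: (@has_mean_cindep _ _ _ (measurableTypeR R) _ (measurableTypeR R) _ P (V (i, j)) (V (i', j'))
  (fun w => normal_prob (M i w) s) (fun w => normal_prob (M i' w) s)
  (mV (i, j)) (mV (i', j')) (mK (i, j)) (mK (i', j')) _
  (fun x => x - b) (fun x => x - b)
  (fun w => M i w - b) (fun w => M i' w - b)) => //.
- move=> C D mC mD; rewrite -cylinder2E// samples_law; last first.
    by move=> k; exact: measurable_cylinder2.
  apply: eq_integral => w _.
  rewrite (prod_cylinder2 (F := fun p => normal_prob (M p.1 w) s))//.
  by move=> k; exact: probability_setT.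
- by move=> w; exact: has_mean_normal.
- by move=> w; exact: has_mean_normal.
- exact: integrable_sqr_mul (mVb (i, j)) (mVb (i', j'))
    (has_mean_sample_sqr i j) (has_mean_sample_sqr i' j').
- exact: has_mean_taskM.
Qed.

End HierarchicalMoments.

(** * Products of independent variables *)

Section Independence.
Context d (T : measurableType d) (R : realType) (P : probability T R).

Lemma has_mean_distribution (U : {mfun T >-> measurableTypeR R}) (u : R) :
  has_mean P U u -> has_mean (distribution P U) (idfun : measurableTypeR R -> R) u.
Proof.
move=> [Ui Uu].
have mE : measurable_fun [set: measurableTypeR R] (EFin \o idfun).
  by apply/measurable_EFinP; exact: measurable_id.
split; first exact: integrable_pushforward.
by rewrite -Uu; exact: (integral_distribution mE Ui).
Qed.

(** Independence is conditional independence with constant kernels, here the distributions of [U1]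
    and [U2]. *)
Lemma has_mean_indep (U1 U2 : T -> R) (u1 u2 : R) :
    (forall C D : set R, measurable C -> measurable D ->
      P (U1 @^-1` C `&` U2 @^-1` D) = (P (U1 @^-1` C) * P (U2 @^-1` D))%E) ->
    has_mean P U1 u1 -> has_mean P U2 u2 ->
    P.-integrable [set: T] (fun w => (U1 w * U2 w)%:E) ->
  has_mean P (fun w => U1 w * U2 w) (u1 * u2).
Proof.
move=> ind h1 h2 h12.
have m1 : measurable_fun [set: T] (U1 : T -> measurableTypeR R).
  exact: has_mean_measurable h1.
have m2 : measurable_fun [set: T] (U2 : T -> measurableTypeR R).
  exact: has_mean_measurable h2.
pose V1 := @mfun_Sub _ _ T (measurableTypeR R) U1 (mem_set m1).
pose V2 := @mfun_Sub _ _ T (measurableTypeR R) U2 (mem_set m2).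
have d1 := @has_mean_distribution V1 _ h1.
have d2 := @has_mean_distribution V2 _ h2.
apply: (@has_mean_cindep _ _ _ (measurableTypeR R) _ (measurableTypeR R) _ P
  U1 U2 (fun=> distribution P V1) (fun=> distribution P V2) m1 m2 _ _ _ idfun idfun
  (cst u1) (cst u2)) => //.
- by move=> C D mC mD; rewrite integral_probability_cst; exact: ind.
- exact: (has_mean_cst P (u1 * u2)).
Qed.

End Independence.

Lemma has_mean_bilinear d (T : measurableType d) (R : realType)
    (mu : {measure set T -> \bar R}) (I J : finType) (p : pred I) (q : pred J)
    (F : I -> T -> R) (G : J -> T -> R) (v : I -> J -> R) :
    (forall i j, p i -> q j -> has_mean mu (fun w => F i w * G j w) (v i j)) ->
  has_mean mu (fun w => (\sum_(i | p i) F i w) * (\sum_(j | q j) G j w))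
    (\sum_(i | p i) \sum_(j | q j) v i j).
Proof.
move=> FG.
apply: (@eq_has_mean _ _ _ _
  (fun w => \sum_(i | p i) \sum_(j | q j) F i w * G j w)) => [w|].
  by rewrite mulr_suml; apply: eq_bigr => i _; rewrite mulr_sumr.
apply: has_mean_sum => i pi; apply: has_mean_sum => j qj; exact: FG.
Qed.

(** * Mean of the statistic in the OUT and IN cases *)

Section Challenge.
Context (disp : measure_display) (Omega : measurableType disp) (R : realType)
  (P : probability Omega R) (d T N k : nat).
Hypotheses (hT : (0 < T)%N) (hN : (0 < N)%N) (hk : (0 < k)%N).
Variables (mubar : 'rV[R]_d) (sigma sigmabar : R).
Hypotheses (sigma0 : sigma != 0) (sigmabar0 : sigmabar != 0).
Variables (mu : 'I_T -> Omega -> 'rV[R]_d)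
  (X : 'I_T -> 'I_N -> Omega -> 'rV[R]_d).
Hypotheses (hmu : iid_tasks P mubar sigmabar mu)
  (hX : samples_given_tasks P sigma mu X).

Let W c (p : 'I_T * 'I_N) w : R := X p.1 p.2 w 0 c - mubar 0 c.

Let T0 : T%:R != 0 :> R. Proof. by rewrite pnatr_eq0 -lt0n. Qed.
Let N0 : N%:R != 0 :> R. Proof. by rewrite pnatr_eq0 -lt0n. Qed.
Let k0 : k%:R != 0 :> R. Proof. by rewrite pnatr_eq0 -lt0n. Qed.

Lemma mu_hat_centered c w : mu_hat X w 0 c - mubar 0 c =
  (T%:R^-1 * N%:R^-1) * \sum_p W c p w.
Proof.
rewrite /mu_hat mxE summxE.
under eq_bigr do rewrite mxE summxE.
rewrite -mulr_sumr pair_big/= mulrA /W sumrB sumr_const card_prod !card_ord mulrBr.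
congr (_ - _); rewrite -[mubar 0 c *+ _]mulr_natr natrM.
by field; rewrite T0 N0.
Qed.

Lemma has_mean_mu_hat c : has_mean P (fun w => mu_hat X w 0 c - mubar 0 c) 0.
Proof.
apply: (eq_has_mean (fun w => esym (mu_hat_centered c w))).
suff h : has_mean P (fun w => \sum_p W c p w) 0.
  by have := has_meanZ (T%:R^-1 * N%:R^-1) h; rewrite mulr0.
by apply: has_mean_sum0 => -[i j] _; exact: has_mean_sample hmu hX c i j.
Qed.

Lemma integrable_mu_hat_sqr c :
  P.-integrable [set: Omega] (fun w => ((mu_hat X w 0 c - mubar 0 c) ^+ 2)%:E).
Proof.
have [h _] := has_meanZ ((T%:R^-1 * N%:R^-1) ^+ 2)
  (@has_mean_bilinear _ _ _ P _ _ predT predT (W c) (W c) _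
    (fun p q _ _ => has_mean_sampleM sigma0 sigmabar0 hmu hX c p.1 p.2 q.1 q.2)).
apply: eq_integrable h => // w _.
by rewrite /= -(expr2 (\sum_p W c p w)) mu_hat_centered [in RHS]exprMn.
Qed.

Lemma has_mean_z_out (mu_out : Omega -> 'rV[R]_d)
    (Y : 'I_k -> Omega -> 'rV[R]_d) :
    out_challenge P mubar sigmabar sigma mu X mu_out Y ->
  has_mean P (z_stat mubar (mu_hat X) (mu_B_out Y)) 0.
Proof.
move=> [hmu_out hY _ indY].
pose V j c w := Y j w 0 c - mubar 0 c.
(* Only the challenge mean is expanded into samples; [mu_hat X] stays whole because independence
   from [Y] is assumed for it. *)
have zE w : z_stat mubar (mu_hat X) (mu_B_out Y) w =
    \sum_(c < d) \sum_(j < k) k%:R^-1 * (V j c w * (mu_hat X w 0 c - mubar 0 c)).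
  rewrite /z_stat /dotp; apply: eq_bigr => c _.
  (* Generalising [mu_hat X w] keeps [mxE] from unfolding it. *)
  move: (mu_hat X w) => h; rewrite /mu_B_out ![in LHS]mxE -mulr_sumr -mulr_suml mulrA mulrC; congr (_ * _).
  rewrite /V sumrB sumr_const card_ord mulrBr summxE; congr (_ - _).
  by rewrite -[mubar 0 c *+ _]mulr_natr; field.
apply: (eq_has_mean (fun w => esym (zE w))).
apply: has_mean_sum0 => c _.
apply: has_mean_sum0 => j _.
suff h : has_mean P (fun w => V j c w * (mu_hat X w 0 c - mubar 0 c)) (0 * 0).
  by have := has_meanZ k%:R^-1 h; rewrite !mulr0.
(* The challenge is itself a hierarchical model with one task, so the same moment lemmas apply. *)
have hV := has_mean_sample sigma0 sigmabar0 hmu_out hY c ord0 j.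
have hV2 := has_mean_sample_sqr sigma0 sigmabar0 hmu_out hY c ord0 j.
apply: has_mean_indep => //.
- have mB (C : set R) : measurable C -> measurable ((fun x => x - mubar 0 c) @^-1` C).
    move=> mC; rewrite -[X in measurable X]setTI.
    have mf : measurable_fun [set: R] (fun x => x - mubar 0 c).
      exact: measurable_funB.
    exact: mf.
  move=> C D mC mD; apply: indY; apply: sub_sigma_algebra.
    by exists j => //; exists c; exists ((fun x => x - mubar 0 c) @^-1` C) => //; exact: mB.
  by exists tt => //; exists c; exists ((fun x => x - mubar 0 c) @^-1` D) => //; exact: mB.
- exact: has_mean_mu_hat.
- apply: integrableM_sqr.
  + exact: has_mean_measurable hV.
  + exact: has_mean_measurable (has_mean_mu_hat c).
  + by have [] := hV2.
  + exact: integrable_mu_hat_sqr.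
Qed.

(** Each [j] in [A] meets the N samples of task [tau], contributing [sigmabar ^+ 2] each, and itself
    once, contributing [sigma ^+ 2]. *)
Lemma sum_covariances (tau : 'I_T) (A : {set 'I_N}) :
  \sum_p \sum_(j in A) ((p.1 == tau)%:R * sigmabar ^+ 2 +
    ((p.1, p.2) == (tau, j))%:R * sigma ^+ 2) =
  #|A|%:R * (N%:R * sigmabar ^+ 2 + sigma ^+ 2) :> R.
Proof.
rewrite exchange_big/= mulr_natl -sumr_const; apply: eq_bigr => j _.
rewrite big_split/=; congr (_ + _).
  rewrite -(pair_big predT predT (fun i j => (i == tau)%:R * sigmabar ^+ 2))/=.
  under eq_bigr do rewrite sumr_const card_ord.
  rewrite (bigD1 tau)//= eqxx mul1r mulr_natl big1 ?addr0// => i /negPf ->.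
  by rewrite mul0r mul0rn.
rewrite (bigD1 (tau, j))//= eqxx mul1r big1 ?addr0// => -[i l] /negPf /= ->.
by rewrite mul0r.
Qed.

(* The statistic for the deterministic index set A, still normalised by k; when
   #|A| != k it differs from the empirical mean over A, but the event S = A then
   has probability 0. *)
Let z_fixed tau (A : {set 'I_N}) : Omega -> R :=
  z_stat mubar (mu_hat X) (fun w => k%:R^-1 *: \sum_(j in A) X tau j w).

Let z_mean (A : {set 'I_N}) : R :=
  d%:R * ((T%:R^-1 * N%:R^-1 * k%:R^-1) *
    (#|A|%:R * (N%:R * sigmabar ^+ 2 + sigma ^+ 2))).

Lemma has_mean_z_fixed tau A : has_mean P (z_fixed tau A) (z_mean A).
Proof.
pose u := (T%:R^-1 * N%:R^-1 * k%:R^-1) *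
  (#|A|%:R * (N%:R * sigmabar ^+ 2 + sigma ^+ 2)).
(* Centring error left when [#|A|] differs from [k]. It multiplies the centred [mu_hat], so it adds
   nothing to the mean. *)
pose e c := k%:R^-1 * #|A|%:R * mubar 0 c - mubar 0 c.
have zE w : \sum_(c < d) ((T%:R^-1 * N%:R^-1 * k%:R^-1) *
      ((\sum_p W c p w) * \sum_(j in A) W c (tau, j) w) +
    e c * (mu_hat X w 0 c - mubar 0 c)) = z_fixed tau A w.
  rewrite /z_fixed /z_stat /dotp; apply: eq_bigr => c _.
  have -> : (k%:R^-1 *: \sum_(j in A) X tau j w - mubar) 0 c =
      k%:R^-1 * (\sum_(j in A) W c (tau, j) w) + e c.
    rewrite !mxE summxE /W sumrB sumr_const /e -[mubar 0 c *+ _]mulr_natr.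
    by ring.
  have -> : (mu_hat X w - mubar) 0 c = mu_hat X w 0 c - mubar 0 c.
    by move: (mu_hat X w) => h; rewrite !mxE.
  by rewrite mu_hat_centered; ring.
apply: (eq_has_mean zE).
have -> : z_mean A = \sum_(c < d) u by rewrite sumr_const card_ord -mulr_natl.
apply: has_mean_sum => c _; rewrite -[u]addr0.
apply: has_meanD.
  apply: has_meanZ; rewrite -(sum_covariances tau); apply: has_mean_bilinear => -[i l] j _ _.
  exact: (has_mean_sampleM sigma0 sigmabar0 hmu hX c i l tau j).
by have := has_meanZ (e c) (has_mean_mu_hat c); rewrite mulr0.
Qed.

(** Independence of [S] is given only against events generated by the data. Taking the generated
    sigma-algebra as the measurable structure on [Omega] turns membership into ordinary
    measurability of a polynomial in the coordinates. *)
Lemma z_fixed_sigma_family tau A (D : set R) : measurable D ->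
  sigma_family (fun p : 'I_T * 'I_N => X p.1 p.2) (z_fixed tau A @^-1` D).
Proof.
move=> mD; pose G := \bigcup_p coord_events (fun w => X p.1 p.2 w).
have mX i j c : measurable_fun [set: g_sigma_algebraType G] (fun w => X i j w 0 c).
  move=> _ C mC; rewrite setTI; apply: sub_sigma_algebra.
  by exists (i, j) => //; exists c; exists C.
have mz : measurable_fun [set: g_sigma_algebraType G] (z_fixed tau A).
  have -> : z_fixed tau A = fun w => \sum_(c < d)
      (T%:R^-1 * (\sum_(i < T) N%:R^-1 * \sum_(j < N) X i j w 0 c) - mubar 0 c) *
      (k%:R^-1 * (\sum_(j < N) (j \in A)%:R * X tau j w 0 c) - mubar 0 c).
    apply/funext => w; apply: eq_bigr => c _; rewrite !mxE !summxE.
    congr ((_ * _ - _) * (_ * _ - _)).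
      by apply: eq_bigr => i _; rewrite mxE summxE.
    by rewrite [LHS]big_mkcond; apply: eq_bigr => j _; case: (j \in A);
      rewrite ?mul1r ?mul0r.
  apply: measurable_sum => c; apply: measurable_funM; apply: measurable_funB => //;
    apply: measurable_funM => //; apply: measurable_sum => i;
    apply: measurable_funM => //.
  by apply: measurable_sum => j; exact: mX.
have := mz measurableT D mD; rewrite setTI; exact.
Qed.

Lemma has_mean_z_in tau (S : Omega -> {set 'I_N}) : (k <= N)%N ->
    in_challenge P k X S ->
  has_mean P (z_stat mubar (mu_hat X) (mu_B_in k X tau S))
    (d%:R / T%:R * (sigmabar ^+ 2 + sigma ^+ 2 / N%:R)).
Proof.
move=> hkN [mS lawS indS].
pose pA (A : {set 'I_N}) : R := if #|A| == k then 'C(N, k)%:R^-1 else 0.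
(* Splitting by the value of [S] turns the random index set into indicators times statistics with a
   fixed set. *)
have zE w : \sum_A (S w == A)%:R * z_fixed tau A w =
    z_stat mubar (mu_hat X) (mu_B_in k X tau S) w.
  rewrite (bigD1 (S w))//= eqxx mul1r big1 ?addr0// => A /negPf SA.
  by rewrite eq_sym SA mul0r.
have -> : d%:R / T%:R * (sigmabar ^+ 2 + sigma ^+ 2 / N%:R) =
    \sum_A pA A * z_mean A.
  (* [z_mean] is the same for all k-subsets, so the uniform weights sum to 1; [k <= N] makes the
     binomial nonzero. *)
  rewrite (eq_bigr (fun A : {set 'I_N} => if #|A| == k then 'C(N, k)%:R^-1 *
    (d%:R / T%:R * (sigmabar ^+ 2 + sigma ^+ 2 / N%:R)) else 0)); last first.
    move=> A _; rewrite /pA /z_mean; case: eqP => [->|]; last by rewrite mul0r.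
    by congr (_ * _); field; rewrite N0 T0 k0.
  rewrite -big_mkcond/= sumr_const.
  have -> : #|[pred A : {set 'I_N} | #|A| == k]| = 'C(N, k).
    rewrite -[in RHS](card_ord N) -card_draws; apply: eq_card => A.
    by rewrite finset.in_set.
  rewrite -[RHS]mulr_natl mulVKf//.
  by rewrite pnatr_eq0 -lt0n bin_gt0.
apply: (eq_has_mean zE); apply: has_mean_sum => A _.
have SAE : (fun w => (S w == A)%:R) = \1_[set w | S w = A] :> (Omega -> R).
  apply/funext => w; rewrite indicE; congr (_%:R); congr nat_of_bool.
  by apply/eqP/idP; rewrite inE.
have hS : has_mean P (fun w => (S w == A)%:R) (pA A).
  rewrite SAE; apply: ge0_has_mean => //.
  by rewrite integral_indic// setIT; exact: lawS.
have [zi _] := has_mean_z_fixed tau A.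
apply: has_mean_indep => //.
- move=> C D mC mD; apply: indS; last exact: z_fixed_sigma_family.
  (* The indicator of S = A is a function of [S], so its preimages are events of [S]. *)
  by exists [set B | C (B == A)%:R].
- exact: has_mean_z_fixed.
- apply: le_integrable zi => //.
    apply/measurable_EFinP; apply: measurable_funM.
      exact: has_mean_measurable hS.
    exact: has_mean_measurable (has_mean_z_fixed tau A).
  move=> w _ /=; rewrite lee_fin normrM.
  by case: (S w == A); rewrite ?normr1 ?normr0 ?mul1r ?mul0r.
Qed.

End Challenge.


Theorem theorem4p1 (R : realType) (disp : measure_display)
    (Omega : measurableType disp) (P : probability Omega R)
    (d T N k : nat)
    (hd : (0 < d)%N) (hT : (0 < T)%N) (hN : (0 < N)%N) (hk : (0 < k)%N)
    (hkN : (k <= N)%N)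
    (mubar : 'rV[R]_d) (sigma sigmabar : R)
    (hsigma : 0 < sigma) (hsigmabar : 0 < sigmabar)
    (mu : 'I_T -> Omega -> 'rV[R]_d)
    (X : 'I_T -> 'I_N -> Omega -> 'rV[R]_d)
    (hmu : iid_tasks P mubar sigmabar mu)
    (hX : samples_given_tasks P sigma mu X)
    (tau : 'I_T) :
  (forall (mu_out : Omega -> 'rV[R]_d) (Y : 'I_k -> Omega -> 'rV[R]_d),
     out_challenge P mubar sigmabar sigma mu X mu_out Y ->
     ('E_P[z_stat mubar (mu_hat X) (mu_B_out Y)])%E = 0%:E) /\
  (forall S : Omega -> {set 'I_N},
     in_challenge P k X S ->
     ('E_P[z_stat mubar (mu_hat X) (mu_B_in k X tau S)])%E =
       (d%:R / T%:R * (sigmabar ^+ 2 + sigma ^+ 2 / N%:R))%:E).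
Proof.
have s0 : sigma != 0 by rewrite gt_eqF.
have sbar0 : sigmabar != 0 by rewrite gt_eqF.
split.
  move=> mu_out Y hY.
  by have [_] := has_mean_z_out hT hN hk s0 sbar0 hmu hX hY; rewrite unlock.
move=> S hS.
by have [_] := has_mean_z_in hT hN hk s0 sbar0 hmu hX tau hkN hS; rewrite unlock.
Qed.
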